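(* Let $X$ be a real random variable with $\mathrm E X>0$ and $0<\mathrm E X^2<\infty$, let $\rho>0$, $u>0$, $\delta:=\rho\,\mathrm E X/\mathrm E X^2$ and $u_0:=u/\mathrm E X^2$. Let $W$ be a standard Brownian motion started at $0$, let $\alpha\in(0,1)$, let $Y_\alpha$ be an inverse $\alpha$-stable subordinator independent of $W$, and let $\Lambda(t)=\int_0^t\lambda(s)\,ds$ with a locally integrable intensity function $\lambda(\cdot)\ge0$ such that $\Lambda$ is unbounded on $[0,\infty)$. Let $T$ be any of the clocks $$T(t)=t,\qquad T(t)=Y_\alpha(t),\qquad T(t)=\Lambda(t),\qquad T(t)=\Lambda(Y_\alpha(t)),$$ corresponding respectively to the classical, the fractional, the non-homogeneous and the fractional non-homogeneous Poisson process. Then, with $$\underline R:=\inf_{t\ge0}\big(u_0+W_{T(t)}+\delta\,T(t)\big),$$ the average capital required to recover the firm from ruin is $$\kappa:=-\mathrm E\big(\underline R\mid\underline R\le0\big)=\frac{\mathrm E X^2}{2\rho\,\mathrm E X}.$$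
   Context: The inverse $\alpha$-stable subordinator is $Y_\alpha(t)=\inf\{w\ge0:L_\alpha(w)>t\}$, where $L_\alpha$ is the $\alpha$-stable subordinator, i.e. the non-decreasing càdlàg Lévy process started at $0$ with $\mathrm E\,e^{-sL_\alpha(t)}=e^{-ts^\alpha}$, $s\ge0$. The process $u_0+W_t+\delta t$ is what the paper calls the limiting case of the classical risk process $u+\mu\lambda(1+\rho)t-\sum_{i\le N(t)}X_i$, with $X$ a generic claim size, $\mu=\mathrm E X$, $\rho$ the safety loading and $u$ the initial capital. The limiting risk process driven by the fractional and/or non-homogeneous Poisson process is this Brownian motion with drift run with the clock $T$. *)

(* Defs.v *)
From mathcomp Require Import all_boot all_order all_algebra.
From mathcomp Require Import all_classical all_reals all_analysis.
Set Implicit Arguments.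
Unset Strict Implicit.
Unset Printing Implicit Defensive.
Import Order.TTheory GRing.Theory Num.Theory.
Import numFieldNormedType.Exports.
Local Open Scope classical_set_scope.
Local Open Scope ring_scope.

(* A real-valued process is a family [X : R -> {RV P >-> R}]; only its values
   at times [t >= 0] are ever constrained or used. *)

(* Taking some [B i := setT] gives the product rule for every subfamily. *)
Definition mutually_independent (R : realType) (d : measure_display)
    (T : measurableType d) (P : probability T R) (n : nat)
    (X : 'I_n -> T -> R) : Prop :=
  forall B : 'I_n -> set R, (forall i, measurable (B i)) ->
    P (\bigcap_(i in [set: 'I_n]) (X i @^-1` B i)) =
    (\prod_(i < n) P (X i @^-1` B i))%E.

Definition independent_increments (R : realType) (d : measure_display)
    (T : measurableType d) (P : probability T R)
    (X : R -> {RV P >-> R}) : Prop :=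
  forall (n : nat) (t : nat -> R), 0 <= t 0%N ->
    {homo t : i j / (i <= j)%N >-> i <= j} ->
    mutually_independent P (fun i : 'I_n => X (t i.+1) \- X (t i)).

Definition stationary_increments (R : realType) (d : measure_display)
    (T : measurableType d) (P : probability T R)
    (X : R -> {RV P >-> R}) : Prop :=
  forall s t : R, 0 <= s -> 0 <= t -> forall B : set R, measurable B ->
    pushforward P (X (s + t) \- X s) B = pushforward P (X t \- X 0) B.

(* The second parameter of [normal_prob] is the standard deviation.  The case
   [s = t] is excluded because [normal_prob 0 0] is not a Dirac mass. *)
Definition brownian_motion (R : realType) (d : measure_display)
    (T : measurableType d) (P : probability T R)
    (W : R -> {RV P >-> R}) : Prop :=
  [/\ {ae P, forall w, W 0 w = 0},
      independent_increments W,
      forall s t : R, 0 <= s -> s < t -> forall B : set R, measurable B ->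
        pushforward P (W t \- W s) B = normal_prob 0 (Num.sqrt (t - s)) B &
      {ae P, forall w, {within `[0, +oo[, continuous (fun t => W t w)}}].

Definition cadlag (R : realType) (f : R -> R) : Prop :=
  (forall t, 0 <= t -> f x @[x --> t^'+] --> f t) /\
  (forall t, 0 < t -> cvg (f x @[x --> t^'-])).

Definition levy_process (R : realType) (d : measure_display)
    (T : measurableType d) (P : probability T R)
    (X : R -> {RV P >-> R}) : Prop :=
  [/\ {ae P, forall w, X 0 w = 0},
      independent_increments X,
      stationary_increments X &
      {ae P, forall w, cadlag (fun t => X t w)}].

Definition stable_subordinator (R : realType) (d : measure_display)
    (T : measurableType d) (P : probability T R) (alpha : R)
    (L : R -> {RV P >-> R}) : Prop :=
  [/\ levy_process L,
      {ae P, forall w,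
        {in `[0, +oo[ &, {homo (fun t => L t w) : s t / s <= t}}} &
      forall s t : R, 0 <= s -> 0 <= t ->
        ('E_P[fun w => expR (- (s * L t w))%R])%E =
          (expR (- (t * s `^ alpha)))%:E].

(* [inf set0 = 0] is irrelevant: almost surely [L] is unbounded. *)
Definition inverse_stable_subordinator (R : realType) (d : measure_display)
    (T : measurableType d) (P : probability T R) (alpha : R)
    (Y : R -> {RV P >-> R}) : Prop :=
  exists L : R -> {RV P >-> R}, stable_subordinator alpha L /\
    {ae P, forall w, forall t : R, 0 <= t ->
      Y t w = inf [set v : R | 0 <= v /\ t < L v w]}.

Definition process_sigma_algebra (R : realType) (d : measure_display)
    (T : measurableType d) (P : probability T R)
    (X : R -> {RV P >-> R}) : set (set T) :=
  <<s \bigcup_(t in `[0, +oo[) g_sigma_algebra_preimage (X t) >>.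

Definition independent_processes (R : realType) (d : measure_display)
    (T : measurableType d) (P : probability T R)
    (X Y : R -> {RV P >-> R}) : Prop :=
  forall A B : set T, process_sigma_algebra X A -> process_sigma_algebra Y B ->
    P (A `&` B) = (P A * P B)%E.

(* [E(Z | A) = E(Z 1_A) / P(A)].  As path properties above hold only almost
   surely and [P] need not be complete, an event of interest may be measurable
   only up to a null set.  [P A] is therefore written ['E_P[\1_A]], which is
   [P A] for measurable [A] and the completed measure of [A] in general. *)
Definition cond_expectation (R : realType) (d : measure_display)
    (T : measurableType d) (P : probability T R)
    (Z : T -> \bar R) (A : set T) : \bar R :=
  ((\int[P]_(w in A) Z w) * ((fine ('E_P[\1_A])%E)^-1)%:E)%E.

Definition cumulative_intensity (R : realType) (lambda : R -> R) (t : R) : R :=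
  \int[lebesgue_measure]_(s in `[0, t]) lambda s.

(* The infimum is taken in [\bar R]. *)
Definition risk_infimum (R : realType) (d : measure_display)
    (T : measurableType d) (P : probability T R) (W : R -> {RV P >-> R})
    (clock : R -> T -> R) (u0 delta : R) (w : T) : \bar R :=
  ereal_inf [set (u0 + W (clock t w) w + delta * clock t w)%:E
            | t in `[0, +oo[].

(* Main.v *)
(* Almost surely every clock maps [0, +oo[ onto [0, +oo[: the stable subordinator
   L is strictly increasing, hence Y(L(v)) = v, and the cumulative intensity is
   continuous and unbounded.  The infimum is therefore u0 - M with
   M = sup_s (- W_s - delta s), whatever the clock.

   M is exponential with rate theta = 2 delta.  Along a grid, exp(theta S_n) is a
   martingale for the walk S_n = - W - delta t; stopping it at the first passage
   above x gives P(M > x) <= exp(- theta x), and the reverse inequality holds in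
   the limit of fine grids, where the overshoot and the mass not yet stopped
   vanish.  Then kappa = E[(M - u0)^+] / P(M >= u0) = 1 / theta. *)
Require Import Defs.
From mathcomp Require Import all_boot all_order all_algebra.
From mathcomp Require Import all_classical all_reals all_analysis.
From mathcomp Require Import measurable_realfun ring lra.
Set Implicit Arguments.
Unset Strict Implicit.
Unset Printing Implicit Defensive.
Import Order.TTheory GRing.Theory Num.Theory.
Import numFieldNormedType.Exports.
Local Open Scope classical_set_scope.
Local Open Scope ring_scope.

(** * Independence *)

(** The rate [2 * delta] is the nonzero root of a^2 / 2 - a delta, the exponent governing E exp(a
    S_t) for S_t = - W_t - delta t. Optional stopping is done by hand: the exponential martingale is
    frozen at a constant after passage, and two consecutive times are compared pointwise, so no
    stopping time is ever formed.

    The reverse inequality has to beat two errors at once. A path not yet stopped is controlled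
    through a smaller exponent [a], whose moment is below 1. A passage jump above [eta] is
    controlled by an exponential tilt [lam], summed over all grid steps. Grid step, horizon and tilt
    are tied together so that both errors vanish while [eta] is still fixed.

    The second obstacle is measurability: continuity of paths and strict monotonicity of L hold only
    off null sets. M is therefore taken as a supremum over all dyadic times, which is measurable
    with no path property at all. The path properties enter only to identify the infimum almost
    surely, and integrals are then transferred by a comparison valid for nonmeasurable
    integrands. *)

Lemma g_sigma_algebra_indep (R : realType) (d : measure_display)
    (T : measurableType d) (P : probability T R) (G : set (set T)) (C : set T) :
  G `<=` measurable -> setI_closed G -> G setT -> measurable C ->
  (forall A, G A -> P (A `&` C) = (P A * P C)%E) ->
  forall A, <<s G >> A -> P (A `&` C) = (P A * P C)%E.
Proof.
move=> mG IG GT mC indG A sA.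
have PC0 : 0 <= fine (P C) by apply: fine_ge0; exact: measure_ge0.
have PCf : P C = (fine (P C))%:E by rewrite fineK// fin_num_measure.
(* Both sides are finite measures in [A], the restriction of P to [C] and P scaled by P(C); they
   agree on the pi-system [G], hence on the sigma-algebra it generates. *)
rewrite -/(mrestr P mC A) muleC PCf.
rewrite -[RHS]/(mscale (NngNum PC0) P A).
apply: (g_sigma_algebra_measure_unique G mG (fun=> setT)) => //.
- by rewrite bigcup_const.
- move=> B GB /=; rewrite /mrestr /mscale/= indG// PCf muleC.
  by rewrite -PCf.
- move=> _; rewrite /= /mrestr setTI -ge0_fin_numE ?measure_ge0//.
  exact: fin_num_measure.
Qed.

Lemma ge0_expectationM_indep (R : realType) (d : measure_display)
    (T : measurableType d) (P : probability T R) (U V : T -> R) :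
  measurable_fun setT U -> measurable_fun setT V ->
  (forall w, 0 <= U w) -> (forall w, 0 <= V w) ->
  (forall A B, measurable A -> measurable B ->
    P (U @^-1` A `&` V @^-1` B) = (P (U @^-1` A) * P (V @^-1` B))%E) ->
  ('E_P[U \* V] = 'E_P[U] * 'E_P[V])%E.
Proof.
move=> mU mV U0 V0 ind.
have mUV : measurable_fun setT (fun w => (U w, V w)).
  exact: measurable_fun_pair.
pose U' : {RV P >-> R} := mfun_Sub (mem_set mU).
pose V' : {RV P >-> R} := mfun_Sub (mem_set mV).
pose UV : {RV P >-> (R * R)%type} := mfun_Sub (mem_set mUV).
have law X : measurable X ->
    (distribution P U' \x distribution P V')%E X = distribution P UV X.
  by move=> mX; exact: product_measure_unique.
(* The absolute values make the integrand nonnegative on the whole plane, for Tonelli; along (U, V)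
   they change nothing. *)
pose f (z : R * R) : \bar R := (`|z.1| * `|z.2|)%:E.
have mf : measurable_fun setT f.
  apply/measurable_EFinP; apply: measurable_funM.
    by apply: measurableT_comp => //; exact: measurable_fst.
  by apply: measurableT_comp => //; exact: measurable_snd.
transitivity (\int[distribution P UV]_z f z)%E.
  rewrite ge0_integral_distribution//; last by move=> z; rewrite lee_fin mulr_ge0.
  rewrite unlock; apply: eq_integral => w _.
  by rewrite /f /= !ger0_norm.
transitivity (\int[distribution P U' \x distribution P V']_z f z)%E.
  by apply/esym/eq_measure_integral => A mA _; exact: law.
rewrite fubini_tonelli1//; last by move=> z; rewrite lee_fin mulr_ge0.
rewrite /fubini_F.
have nm : measurable_fun setT (fun x : R => `|x|%:E : \bar R).
  by apply/measurable_EFinP; exact: normr_measurable.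
under eq_integral => x _.
  rewrite /f /=; under eq_integral do rewrite EFinM.
  rewrite ge0_integralZl//; [|by move=> *; rewrite ?lee_fin..].
  over.
rewrite /= ge0_integralZr//; last by apply: integral_ge0 => *; rewrite lee_fin.
rewrite !ge0_integral_distribution//.
rewrite unlock; congr (_ * _)%E; apply: eq_integral => w _ /=.
  by rewrite ger0_norm.
by rewrite ger0_norm.
Qed.

(** * First passage of a random walk *)

Lemma ge0_expectationD (R : realType) (d : measure_display)
    (T : measurableType d) (P : probability T R) (U V : T -> R) :
  measurable_fun setT U -> measurable_fun setT V ->
  (forall w, 0 <= U w) -> (forall w, 0 <= V w) ->
  ('E_P[U \+ V] = 'E_P[U] + 'E_P[V])%E.
Proof.
move=> mU mV U0 V0; rewrite unlock -ge0_integralD//.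
- by move=> w _; rewrite lee_fin.
- exact/measurable_EFinP.
- by move=> w _; rewrite lee_fin.
- exact/measurable_EFinP.
Qed.

Lemma ge0_expectationZl (R : realType) (d : measure_display)
    (T : measurableType d) (P : probability T R) (c : R) (U : T -> R) :
  measurable_fun setT U -> 0 <= c -> (forall w, 0 <= U w) ->
  ('E_P[fun w => (c * U w)%R] = c%:E * 'E_P[U])%E.
Proof.
move=> mU c0 U0; rewrite unlock -ge0_integralZl//.
- exact/measurable_EFinP.
- by move=> w _; rewrite lee_fin.
Qed.

Section random_walk.
Context (R : realType) (d : measure_display) (T : measurableType d).
Variable P : probability T R.

Section past.
Variable xi : nat -> T -> R.
Hypothesis mxi : forall i, measurable_fun setT (xi i).
Hypothesis ixi : forall n, mutually_independent P (fun i : 'I_n => xi i).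

(** A pi-system generating the sigma-algebra of the first [j] variables, [xi 0] to [xi (j - 1)];
    [xi j] is the next, independent step. *)
Definition past_rectangles (j : nat) : set (set T) :=
  [set A | exists B : nat -> set R, (forall i, measurable (B i)) /\
    A = \bigcap_(i in `I_j) xi i @^-1` B i].

Lemma past_rectangles_measurable j : past_rectangles j `<=` measurable.
Proof.
move=> _ [B [mB ->]]; apply: bigcap_measurableType => i _.
by rewrite -[X in measurable X]setTI; exact: mxi.
Qed.

Lemma past_rectangles_setI j : setI_closed (past_rectangles j).
Proof.
move=> _ _ [A [mA ->]] [B [mB ->]]; exists (fun i => A i `&` B i); split.
  by move=> i; exact: measurableI.
by rewrite -bigcapI.
Qed.

Lemma past_rectangles_setT j : past_rectangles j setT.
Proof.
exists (fun=> setT); split => //.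
by apply/esym; rewrite -subTset => w _ i _.
Qed.

Lemma past_indep_event j (A : set T) (B : set R) :
  <<s past_rectangles j >> A -> measurable B ->
  P (A `&` xi j @^-1` B) = (P A * P (xi j @^-1` B))%E.
Proof.
move=> sA mB; apply: g_sigma_algebra_indep sA.
- exact: past_rectangles_measurable.
- exact: past_rectangles_setI.
- exact: past_rectangles_setT.
- by rewrite -[X in measurable X]setTI; exact: mxi.
move=> _ [C [mC ->]].
(* Index [j] carries [B], so a rectangle in the first [j.+1] variables is the past rectangle met
   with the new event. *)
pose D (C : nat -> set R) i := if (i < j)%N then C i else B.
have mD i : measurable (D C i) by rewrite /D; case: ifP.
have bigcap_ord n (E : nat -> set R) :
    \bigcap_(i in [set: 'I_n]) (xi i @^-1` E i) =
    \bigcap_(i in `I_n) (xi i @^-1` E i).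
  apply/seteqP; split => w /= h i; last by move=> _; apply: h => /=.
  by move=> ij; exact: (h (Ordinal ij)).
have DB : D C j = B by rewrite /D ltnn.
have DC (i : 'I_j) : D C i = C i by rewrite /D ltn_ord.
have := ixi (fun i : 'I_j.+1 => mD i).
rewrite (bigcap_ord _ (D C)) big_ord_recr/= DB.
under eq_bigr do rewrite DC.
rewrite -(ixi (fun i : 'I_j => mC i)) (bigcap_ord _ C) => <-.
congr (P _); apply/seteqP; split => w /=.
- move=> [wC wB] i; rewrite /= ltnS leq_eqVlt => /predU1P[->|ij].
    by rewrite DB.
  by rewrite /D ij; exact: wC.
- move=> wD; split => [i /= ij|].
    by have := wD i (ltnW ij); rewrite /D ij.
  by have := wD j (ltnSn j); rewrite DB.
Qed.

Lemma past_measurable_xi j i : (i < j)%N ->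
  @measurable_fun _ _ (g_sigma_algebraType (past_rectangles j)) R setT (xi i).
Proof.
move=> ij _ B mB; rewrite setTI; apply: sub_sigma_algebra.
exists (fun k => if k == i then B else setT); split.
  by move=> k; case: ifP.
apply/seteqP; split => [w wB k /= kj|w /(_ i ij)]; last by rewrite eqxx.
by case: eqP => [->|].
Qed.

Definition partial_sum n w : R := \sum_(i < n) xi i w.

Definition survival (x : R) n : set T :=
  [set w | forall i, (i <= n)%N -> partial_sum i w <= x].

Lemma past_measurable_partial_sum j i : (i <= j)%N ->
  @measurable_fun _ _ (g_sigma_algebraType (past_rectangles j)) R setT
    (partial_sum i).
Proof.
move=> ij; apply: measurable_sum => k; apply: past_measurable_xi.
by rewrite (leq_trans _ ij).
Qed.

Lemma past_measurable_survival x j : <<s past_rectangles j >> (survival x j).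
Proof.
rewrite [X in _ X](_ : _ =
    \bigcap_(i in `I_j.+1) (partial_sum i @^-1` `]-oo, x])).
  apply: (@bigcap_measurableType _ (g_sigma_algebraType (past_rectangles j))).
  move=> i /=; rewrite ltnS => ij; rewrite -[X in measurable X]setTI.
  exact: past_measurable_partial_sum.
apply/seteqP; split => w /= h i.
  by rewrite /= ltnS => /h; rewrite in_itv.
by move=> ij; have /= := h i; rewrite ltnS in_itv; exact.
Qed.

Lemma past_measurableW j (U : T -> R) :
  @measurable_fun _ _ (g_sigma_algebraType (past_rectangles j)) R setT U ->
  measurable_fun setT U.
Proof.
move=> mU _ B mB; have := mU measurableT B mB.
exact: (smallest_sub (sigma_algebra_measurable _) (@past_rectangles_measurable j)).
Qed.

Lemma ge0_expectationM_past j (U : T -> R) (g : R -> R) :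
  @measurable_fun _ _ (g_sigma_algebraType (past_rectangles j)) R setT U ->
  measurable_fun setT g -> (forall w, 0 <= U w) -> (forall y, 0 <= g y) ->
  ('E_P[U \* (g \o xi j)] = 'E_P[U] * 'E_P[g \o xi j])%E.
Proof.
move=> mU mg U0 g0; apply: ge0_expectationM_indep => //.
- exact: past_measurableW mU.
- exact: measurableT_comp.
- by move=> w; exact: g0.
move=> A B mA mB; rewrite comp_preimage; apply: past_indep_event.
  by have := mU measurableT A mA; rewrite setTI.
by rewrite -[X in measurable X]setTI; exact: mg.
Qed.

Section hitting.
Variables (m : R -> R) (theta x : R).
Hypothesis mgf_xi : forall i a, 0 <= a ->
  'E_P[fun w => expR (a * xi i w)]%E = (m a)%:E.
Hypothesis theta0 : 0 <= theta.
Hypothesis m_theta : m theta = 1.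
Hypothesis x0 : 0 <= x.

Let S := partial_sum.
Let D := survival x.
Let crossing n : set T := ~` D n.

Let SS n w : S n.+1 w = S n w + xi n w.
Proof. by rewrite /S/partial_sum big_ord_recr. Qed.

Let mS n : measurable_fun setT (S n).
Proof. exact: (past_measurableW (past_measurable_partial_sum (leqnn n))). Qed.

Lemma measurable_survival n : measurable (survival x n).
Proof.
apply: (smallest_sub (sigma_algebra_measurable _) (@past_rectangles_measurable n)).
exact: past_measurable_survival.
Qed.

Let mD n : measurable (D n). Proof. exact: measurable_survival. Qed.

Let mC n : measurable (crossing n). Proof. exact: measurableC. Qed.

Lemma mgf_partial_sum n a : 0 <= a ->
  'E_P[fun w => expR (a * partial_sum n w)]%E = (m a ^+ n)%:E.
Proof.
move=> a0; elim: n => [|n IH].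
  rewrite expr0 -[RHS](expectation_cst P 1); congr expectation.
  by apply/funext => w; rewrite /partial_sum big_ord0 mulr0 expR0.
rewrite exprSr EFinM -IH -(mgf_xi n a0).
have me : measurable_fun setT (fun y : R => expR (a * y)).
  by apply: measurableT_comp => //; exact: mulrl_measurable.
rewrite -[X in (_ * X)%E]/('E_P[(fun y => expR (a * y)) \o xi n])%E.
rewrite -(@ge0_expectationM_past n)//.
- congr expectation; apply/funext => w /=.
  by rewrite -expRD -mulrDr -SS.
- exact: (measurableT_comp me (past_measurable_partial_sum (leqnn n))).
Qed.

(* The exponential martingale at time [n], its value after the first passage
   being replaced by [C]: [C = exp(theta x)] is below the true value, and
   [C = exp(theta (x + eta))] is above it unless the passage jump exceeds
   [eta]. *)
Let Phi C n w : R := \1_(D n) w * expR (theta * S n w) + C * \1_(crossing n) w.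
(** The walk has moved to time [n.+1] while the stopping decision is still that of time [n]. Passing
    from [Phi C n] to [Phi' C n] preserves the mean; passing on to [Phi C n.+1] is a pointwise
    comparison. *)
Let Phi' C n w : R :=
  \1_(D n) w * expR (theta * S n.+1 w) + C * \1_(crossing n) w.


Let mexp n a : measurable_fun setT (fun w => expR (a * S n w)).
Proof.
by apply: measurableT_comp => //; exact: measurable_funM.
Qed.

Let mPhi C n : measurable_fun setT (Phi C n).
Proof. by apply: measurable_funD; apply: measurable_funM. Qed.

Let mPhi' C n : measurable_fun setT (Phi' C n).
Proof. by apply: measurable_funD; apply: measurable_funM. Qed.

Let Phi_ge0 C n w : 0 <= C -> 0 <= Phi C n w.
Proof. by move=> C0; rewrite addr_ge0// mulr_ge0// expR_ge0. Qed.

Let Phi'_ge0 C n w : 0 <= C -> 0 <= Phi' C n w.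
Proof. by move=> C0; rewrite addr_ge0// mulr_ge0// expR_ge0. Qed.

Let EPhi C n : 0 <= C -> 'E_P[Phi C n]%E = 'E_P[Phi' C n]%E.
Proof.
move=> C0.
rewrite !ge0_expectationD//; first last.
- by move=> w; rewrite mulr_ge0// expR_ge0.
- exact: measurable_funM.
- exact: measurable_funM.
- by move=> w; rewrite mulr_ge0// expR_ge0.
- exact: measurable_funM.
- exact: measurable_funM.
congr (_ + _)%E.
have me : measurable_fun setT (fun y : R => expR (theta * y)).
  by apply: measurableT_comp => //; exact: mulrl_measurable.
have U0 w : 0 <= \1_(D n) w * expR (theta * S n w).
  by rewrite mulr_ge0// expR_ge0.
have pU : @measurable_fun _ _ (g_sigma_algebraType (past_rectangles n)) R setT
    (fun w => \1_(D n) w * expR (theta * S n w)).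
  apply: measurable_funM.
    by apply: measurable_indic; exact: (@past_measurable_survival x n).
  exact: (measurableT_comp me (past_measurable_partial_sum (leqnn n))).
have := ge0_expectationM_past pU me U0 (fun y => expR_ge0 (theta * y)).
rewrite [X in (_ * X)%E](_ : _ = 1%E).
  rewrite mule1 => <-; congr expectation; apply/funext => w /=.
  by rewrite -mulrA -expRD -mulrDr -SS.
by rewrite -[LHS]/('E_P[fun w => expR (theta * xi n w)])%E mgf_xi// m_theta.
Qed.

Let Phi0 C : Phi C 0 = cst 1.
Proof.
apply/funext => w; have D0 : D 0 w.
  by move=> i; rewrite leqn0 => /eqP ->; rewrite /partial_sum big_ord0.
rewrite /Phi /crossing !indicE mem_set// memNset /=; last by move=> /(_ D0).
by rewrite /S /partial_sum big_ord0 mulr0 expR0 mulr1 mulr0 addr0.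
Qed.

Let survivalW n w : D n.+1 w -> D n w.
Proof. by move=> h i ile; apply: h; exact: (leq_trans ile). Qed.

Let crossedS n w : D n w -> ~ D n.+1 w -> x < S n.+1 w.
Proof.
move=> Dn nDn1; rewrite ltNge; apply/negP => Sx; apply: nDn1 => i.
by rewrite leq_eqVlt ltnS => /predU1P[->//|]; exact: Dn.
Qed.

Let last_le n w : D n w -> S n w <= x.
Proof. by move=> /(_ n (leqnn n)). Qed.

Let PhiE C n w : Phi C n w =
  if w \in D n then expR (theta * S n w) else C.
Proof.
rewrite /Phi !indicE /crossing in_setC; case: (w \in D n) => /=.
  by rewrite mul1r mulr0 addr0.
by rewrite mul0r mulr1 add0r.
Qed.

Let Phi'E C n w : Phi' C n w =
  if w \in D n then expR (theta * S n.+1 w) else C.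
Proof.
rewrite /Phi' !indicE /crossing in_setC; case: (w \in D n) => /=.
  by rewrite mul1r mulr0 addr0.
by rewrite mul0r mulr1 add0r.
Qed.

(** A passage at time [n.+1] replaces exp(theta S) by the smaller exp(theta x), so the mean can only
    decrease from its initial value 1. *)
Let Phi_le1 n : ('E_P[Phi (expR (theta * x)) n] <= 1)%E.
Proof.
have C0 := expR_ge0 (theta * x).
elim: n => [|n IH]; first by rewrite Phi0 expectation_cst.
apply: (le_trans _ IH); rewrite [leRHS]EPhi//.
apply: expectation_le => //.
- by move=> w; exact: Phi_ge0.
- by move=> w; exact: Phi'_ge0.
apply: aeW => w; rewrite PhiE Phi'E.
have [Dn1|nDn1] := boolP (w \in D n.+1).
  by rewrite mem_set//; apply: survivalW; rewrite inE in Dn1.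
have [Dn|//] := boolP (w \in D n).
rewrite ler_expR ler_wpM2l// ltW// crossedS//; first by rewrite inE in Dn.
by move/mem_set; exact/negP.
Qed.

Lemma crossing_upper n :
  (P (~` survival x n) <= (expR (- (theta * x)))%:E)%E.
Proof.
have C0 := expR_gt0 (theta * x).
rewrite expRN -(@lee_pmul2l _ (expR (theta * x))%:E)// -EFinM mulfV ?gt_eqF//.
apply: (le_trans _ (Phi_le1 n)); rewrite -(expectation_indic P (mC n)).
rewrite -ge0_expectationZl//.
apply: expectation_le => //.
- exact: measurable_funM.
- by move=> w; rewrite Phi_ge0// ltW.
by apply: aeW => w; rewrite /Phi lerDr mulr_ge0// expR_ge0.
Qed.

(** The unit mass of the martingale splits into paths stopped with overshoot at most [eta], paths
    not yet stopped, and an exponential bound on jumps above [eta], paid once per step. *)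
Lemma crossing_lower n (eta lam a : R) :
  0 <= eta -> 0 <= lam -> 0 <= a -> a <= theta ->
  (1 <= (expR (theta * (x + eta)))%:E * P (~` survival x n)
    + (expR ((theta - a) * x) * m a ^+ n
       + n%:R * (expR (theta * x - lam * eta) * m (theta + lam)))%:E)%E.
Proof.
move=> eta0 lam0 a0 atheta.
pose C := expR (theta * (x + eta)).
have C0 : 0 <= C by exact: expR_ge0.
pose k := expR (theta * x - lam * eta) * m (theta + lam).
have k0 : 0 <= expR (theta * x - lam * eta) by exact: expR_ge0.
(* If the passage jump is at most [eta], the walk lands below x + eta and [C] dominates. Otherwise
   exp(lam (xi - eta)) >= 1, and multiplying by it bounds the lost value by a tilted moment of
   [xi j]. *)
have step j : ('E_P[Phi C j] <= 'E_P[Phi C j.+1] + k%:E)%E.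
  have mxe : measurable_fun setT (fun w => expR ((theta + lam) * xi j w)).
    by apply: measurableT_comp => //; exact: measurable_funM.
  rewrite EPhi// /k EFinM -(@mgf_xi j); last by rewrite addr_ge0.
  rewrite -ge0_expectationZl//.
  rewrite -ge0_expectationD//; first last.
  - by move=> w; exact: Phi_ge0.
  - exact: measurable_funM.
  apply: expectation_le => //.
  - by apply: measurable_funD => //; exact: measurable_funM.
  - by move=> w; exact: Phi'_ge0.
  - by move=> w; rewrite addr_ge0// ?Phi_ge0// mulr_ge0// expR_ge0.
  apply: aeW => w; rewrite /= PhiE Phi'E -expRD.
  have e0 := expR_ge0 (theta * x - lam * eta + (theta + lam) * xi j w).
  have [Dn1|nDn1] := boolP (w \in D j.+1).
    rewrite mem_set; last by apply: survivalW; rewrite inE in Dn1.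
    by rewrite lerDl.
  have [Dn|//] := boolP (w \in D j); last by rewrite lerDl.
  rewrite inE in Dn; have Sx := last_le Dn.
  rewrite /C; have [xe|xe] := leP (xi j w) eta.
    rewrite (@le_trans _ _ (expR (theta * (x + eta))))//; last by rewrite lerDl.
    by rewrite ler_expR ler_wpM2l// SS lerD.
  rewrite (@le_trans _ _
    (expR (theta * x - lam * eta + (theta + lam) * xi j w)))//; last first.
    by rewrite lerDr.
  rewrite ler_expR SS mulrDl addrACA -subr_ge0 [leRHS](_ : _ =
    theta * (x - S j w) + lam * (xi j w - eta)); last by ring.
  by rewrite addr_ge0// mulr_ge0// subr_ge0// ltW.
have iter j : (1 <= 'E_P[Phi C j] + (j%:R * k)%:E)%E.
  elim: j => [|j IH]; first by rewrite Phi0 expectation_cst mul0r adde0.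
  rewrite (le_trans IH)// -natr1 mulrDl mul1r [(_ + k)%R]addrC EFinD addeA.
  by rewrite leeD2r.
rewrite (le_trans (iter n))// EFinD addeA leeD2r//.
rewrite ge0_expectationD//; first last.
- by move=> w; rewrite mulr_ge0.
- exact: measurable_funM.
- exact: measurable_funM.
rewrite addeC ge0_expectationZl// expectation_indic// leeD2l//.
rewrite EFinM -(mgf_partial_sum n a0) -ge0_expectationZl//.
apply: expectation_le => //.
- exact: measurable_funM.
- exact: measurable_funM.
apply: aeW => w; rewrite indicE -expRD.
have [Dn|] := boolP (w \in D n); last by rewrite mul0r expR_ge0.
(* On [D n], theta S = (theta - a) S + a S with S <= x in the first term; only the moment of order
   [a] remains. *)
rewrite mul1r ler_expR -subr_ge0 [leRHS](_ : _ = (theta - a) * (x - S n w)).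
  by rewrite mulr_ge0 ?subr_ge0// last_le//; rewrite inE in Dn.
by rewrite /S; ring.
Qed.

End hitting.
End past.
End random_walk.

(** * Brownian motion with drift on dyadic grids *)

(** The Radon-Nikodym derivative and [normal_pdf] have the same integral over every measurable set,
    hence agree almost everywhere. *)
Lemma ge0_integral_normal_prob (R : realType) (m s : R) (f : R -> \bar R) :
  measurable_fun setT f -> (forall x, (0 <= f x)%E) ->
  (\int[normal_prob m s]_x f x =
   \int[lebesgue_measure]_x (f x * (normal_pdf m s x)%:E))%E.
Proof.
move=> mf f0.
have dom := normal_prob_dominates m s.
rewrite -(Radon_Nikodym_SigmaFinite.change_of_variables dom)//.
have mpdf : measurable_fun setT (fun x => (normal_pdf m s x)%:E).
  by apply/measurable_EFinP; exact: measurable_normal_pdf.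
have irn := Radon_Nikodym_SigmaFinite.f_integrable dom.
apply: ae_eq_integral => //.
- by apply: emeasurable_funM => //; exact: measurable_int irn.
- exact: emeasurable_funM.
apply: ae_eqe_mul2l; apply: integral_ae_eq => //.
move=> A _ mA; rewrite -Radon_Nikodym_SigmaFinite.f_integral//.
Qed.

(** Completing the square: exp(a x) times the centred density is a constant multiple of the density
    centred at a s^2, which has mass 1. *)
Lemma normal_prob_mgf (R : realType) (s a : R) : s != 0 ->
  (\int[normal_prob 0 s]_x (expR (a * x))%:E =
   (expR (a ^+ 2 * s ^+ 2 / 2))%:E)%E.
Proof.
move=> s0.
have me : measurable_fun setT (fun x : R => (expR (a * x))%:E).
  by apply/measurable_EFinP; apply: measurableT_comp.
rewrite ge0_integral_normal_prob//.
have shift (x : R) : ((expR (a * x))%:E * (normal_pdf 0 s x)%:E =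
    (expR (a ^+ 2 * s ^+ 2 / 2))%:E * (normal_pdf (a * s ^+ 2) s x)%:E)%E.
  rewrite -!EFinM !normal_pdfE//; congr EFin.
  rewrite /normal_fun !(mulrCA _ (normal_peak s)) -!expRD; congr (_ * expR _).
  by field.
under eq_integral do rewrite shift.
rewrite ge0_integralZl ?integral_normal_pdf ?mule1//.
- by apply/measurable_EFinP; exact: measurable_normal_pdf.
- by move=> x _; rewrite lee_fin normal_pdf_ge0.
Qed.

(* [lebesgue_measure] and [normal_prob] live on [measurableTypeR R], which has
   the same measurable sets as [R] but another display. *)
Lemma normal_expectation_expR (R : realType) (d : measure_display)
    (T : measurableType d) (P : probability T R) (V : T -> R) (s a : R) :
  measurable_fun setT V -> s != 0 ->
  (forall B, measurable B -> pushforward P V B = normal_prob 0 s B) ->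
  'E_P[fun w => expR (a * V w)]%E = (expR (a ^+ 2 * s ^+ 2 / 2))%:E.
Proof.
move=> mV s0 law.
have mV' : @measurable_fun _ _ T (measurableTypeR R) setT V.
  by move=> _ B mB; exact: mV.
pose V' := @mfun_Sub _ _ T (measurableTypeR R) V (mem_set mV').
have me : @measurable_fun _ _ (measurableTypeR R) _ setT
    (fun x : R => (expR (a * x))%:E).
  by apply/measurable_EFinP; apply: measurableT_comp.
rewrite unlock -normal_prob_mgf//.
have -> : (\int[normal_prob 0 s]_x (expR (a * x))%:E =
    \int[distribution P V']_x (expR (a * x))%:E)%E.
  by apply: eq_measure_integral => A mA _; exact/esym/law.
rewrite ge0_integral_pushforward//.
Qed.

(** One term of the exponential series. Power 1 gives exp(-1/e) <= e, for limits to 0; power 5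
    outweighs the number 16^k of grid steps. *)
Lemma expRN_le (R : realType) n (y : R) : 0 < y ->
  expR (- y) <= n.+1`!%:R / y ^+ n.+1.
Proof.
move=> y0; have yn0 : 0 < y ^+ n.+1 by rewrite exprn_gt0.
have f0 : 0 < n.+1`!%:R :> R by rewrite ltr0n fact_gt0.
rewrite expRN -[leRHS]invrK invf_div lef_pV2 ?posrE ?expR_gt0 ?divr_gt0//.
by rewrite (le_trans _ (expR_ge1Dxn n (ltW y0)))// lerDr.
Qed.

(** * Dyadic time grids *)

Section dyadic.
Context {R : realType}.

(** Powers of 4 make the square root of the step, the scale of Brownian increments, equal to
    2^-k. *)
Definition dyadic (k i : nat) : R := i%:R / 4%:R ^+ k.

Lemma dyadic0 k : dyadic k 0 = 0. Proof. by rewrite /dyadic mul0r. Qed.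

Lemma dyadic_ge0 k i : 0 <= dyadic k i.
Proof. by rewrite divr_ge0// exprn_ge0. Qed.

Lemma dyadicS k i : dyadic k i.+1 = dyadic k i + (4%:R ^+ k)^-1.
Proof. by rewrite /dyadic -natr1 mulrDl mul1r. Qed.

Lemma dyadic_refine k i : dyadic k.+1 (4 * i) = dyadic k i.
Proof. by rewrite /dyadic exprS natrM invfM mulrACA divff// mul1r. Qed.

Lemma dyadic_between (p q : R) : 0 <= p -> p < q ->
  exists k i, p <= dyadic k i /\ dyadic k i.+1 <= q.
Proof.
move=> p0 pq; have qp0 : 0 < q - p by rewrite subr_gt0.
(* Two steps must fit into the gap: the first grid point after [p] is within one step of it, and its
   successor within two. *)
pose k := Num.bound (2 / (q - p)).
have k0 : 0 < 4 ^+ k :> R by rewrite exprn_gt0.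
have hk : 2 / 4 ^+ k <= q - p.
  rewrite ler_pdivrMr// mulrC -ler_pdivrMr//.
  rewrite (le_trans (ltW (archi_boundP _)))//; first by rewrite divr_ge0// ltW.
  by rewrite -natrX ler_nat ltnW// ltn_expl.
have /andP[lo up] := truncn_itv (mulr_ge0 p0 (ltW k0)).
exists k, (Num.truncn (p * 4 ^+ k)).+1; split.
  by rewrite ler_pdivlMr// ltW.
rewrite -ler_pdivrMr// in lo.
by rewrite dyadicS /dyadic -natr1; lra.
Qed.

End dyadic.

(** * Passage probabilities of the drifted Brownian motion on the grids *)

Section brownian_drawdown.
Context (R : realType) (d : measure_display) (T : measurableType d).
Variables (P : probability T R) (W : R -> {RV P >-> R}) (delta : R).
Hypothesis bmW : brownian_motion W.
Hypothesis delta0 : 0 < delta.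

(** Subtracting [W 0] makes the value at time 0 vanish at every [w], not just almost surely, so it
    is exactly a partial sum of its grid steps. *)
Definition drawdown (t : R) (w : T) : R := - (W t w - W 0 w) - delta * t.

Definition drawdown_step k i w : R :=
  drawdown (dyadic k i.+1) w - drawdown (dyadic k i) w.

Let step_gt0 k : 0 < (4%:R ^+ k)^-1 :> R.
Proof. by rewrite invr_gt0 exprn_gt0. Qed.

Lemma measurable_drawdown t : measurable_fun setT (drawdown t).
Proof.
apply: measurable_funB => //; apply: measurableT_comp => //.
exact: measurable_funB.
Qed.

Let mstep k i : measurable_fun setT (drawdown_step k i).
Proof. by apply: measurable_funB; exact: measurable_drawdown. Qed.

Lemma drawdown_stepE k i w : drawdown_step k i w =
  - (W (dyadic k i.+1) w - W (dyadic k i) w) - delta / 4%:R ^+ k.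
Proof. by rewrite /drawdown_step /drawdown dyadicS; ring. Qed.

Lemma partial_sum_drawdown_step k n w :
  partial_sum (drawdown_step k) n w = drawdown (dyadic k n) w.
Proof.
rewrite /partial_sum; elim: n => [|n IH].
  by rewrite big_ord0 dyadic0 /drawdown subrr oppr0 mulr0 subrr.
by rewrite big_ord_recr/= IH /drawdown_step; ring.
Qed.

Lemma drawdown_step_indep k n :
  mutually_independent P (fun i : 'I_n => drawdown_step k i).
Proof.
case: bmW => _ indep _ _ B mB.
pose f y : R := - y - delta / 4%:R ^+ k.
have mf : measurable_fun setT f.
  by apply: measurable_funB => //; exact: measurableT_comp.
have fE (i : 'I_n) : drawdown_step k i @^-1` B i =
    (W (dyadic k i.+1) \- W (dyadic k i)) @^-1` (f @^-1` B i).
  by apply/seteqP; split => w /=; rewrite drawdown_stepE.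
under eq_bigr do rewrite fE.
under eq_bigcapr do rewrite fE.
apply: (indep n (dyadic k)).
- by rewrite dyadic0.
- by move=> i j ij; rewrite ler_wpM2r ?ler_nat// ltW.
- by move=> i; rewrite -[X in measurable X]setTI; exact: mf.
Qed.

(** Exponential moment of a normal variable with mean - delta 4^-k and variance 4^-k. It equals 1 at
    a = 2 delta and is least at a = delta; both values are used. *)
Definition drawdown_mgf k (a : R) : R :=
  expR ((a ^+ 2 / 2 - a * delta) / 4%:R ^+ k).

Lemma drawdown_step_mgf k i (a : R) :
  'E_P[fun w => expR (a * drawdown_step k i w)]%E = (drawdown_mgf k a)%:E.
Proof.
case: bmW => _ _ gauss _.
pose s : R := Num.sqrt (4%:R ^+ k)^-1.
have s2 : s ^+ 2 = (4%:R ^+ k)^-1 by rewrite sqr_sqrtr// ltW.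
have s0 : s != 0 by rewrite sqrtr_eq0 -ltNge.
pose V := W (dyadic k i.+1) \- W (dyadic k i).
have law B : measurable B -> pushforward P V B = normal_prob 0 s B.
  move=> mB; have lt : dyadic k i < dyadic k i.+1 :> R by rewrite dyadicS ltrDl.
  have := gauss _ _ (dyadic_ge0 k i) lt B mB.
  by rewrite (_ : _ - _ = (4%:R ^+ k)^-1)//; rewrite dyadicS addrAC subrr add0r.
have mV : measurable_fun setT V by exact: measurable_funB.
have := normal_expectation_expR (- a) mV s0 law.
rewrite sqrrN s2 => mgfV.
transitivity ((expR (- a * delta / 4%:R ^+ k))%:E *
    'E_P[fun w => (expR (- a * V w))%R])%E.
  rewrite -ge0_expectationZl//.
    congr expectation; apply/funext => w; rewrite -expRD; congr expR.
    by rewrite drawdown_stepE /V /=; ring.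
  by apply: measurableT_comp => //; exact: measurable_funM.
rewrite mgfV -EFinM -expRD; congr (expR _)%:E.
by field.
Qed.

(* The grid has step [4^-k] and horizon [4^k]; [crossing_lower] is used with
   [lam = 2^k], the inverse square root of the step. *)
Definition grid_crossing (x : R) k : set T :=
  ~` survival (drawdown_step k) x (16 ^ k).

Lemma grid_crossingP x k w : grid_crossing x k w <->
  exists2 i, (i <= 16 ^ k)%N & x < drawdown (dyadic k i) w.
Proof.
split=> [/existsNP[i /not_implyP[ik /negP]]|[i ik xi] /(_ i ik)].
  by rewrite -ltNge partial_sum_drawdown_step => xi; exists i.
by rewrite partial_sum_drawdown_step leNgt xi.
Qed.

Lemma measurable_grid_crossing x k : measurable (grid_crossing x k).
Proof. exact/measurableC/measurable_survival. Qed.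

(** Index [i] becomes [4 * i] on the next grid, and the bound on indices grows by 16, so old times
    survive and the horizon lengthens. *)
Lemma grid_crossing_nondecreasing x : nondecreasing_seq (grid_crossing x).
Proof.
apply: homo_leq => [A|A B C|k]; first exact: lexx.
  exact: le_trans.
apply/subsetPset => w /grid_crossingP[i ik xi]; apply/grid_crossingP.
exists (4 * i)%N; last by rewrite dyadic_refine.
by rewrite expnS leq_mul.
Qed.

Let theta := 2 * delta.
Let theta0 : 0 <= theta. Proof. by rewrite mulr_ge0// ltW. Qed.

Let mgf_theta k : drawdown_mgf k theta = 1.
Proof.
rewrite /drawdown_mgf -[RHS]expR0; congr expR.
by rewrite (_ : _ - _ = 0) ?mul0r// /theta; field.
Qed.

Lemma grid_crossing_upper x k : 0 <= x ->
  (P (grid_crossing x k) <= (expR (- (theta * x)))%:E)%E.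
Proof.
move=> x0; exact: (crossing_upper (mstep k) (@drawdown_step_indep k)
  (fun i a _ => drawdown_step_mgf k i a) theta0 (mgf_theta k) x0).
Qed.

Lemma grid_crossing_lower x eta : 0 <= x -> 0 < eta ->
  exists K, forall k,
    (1 <= (expR (theta * (x + eta)))%:E * P (grid_crossing x k)
          + (K / 2 ^+ k)%:E)%E.
Proof.
move=> x0 eta0.
(* Unstopped mass: [a = delta], where the moment is least, leaves exp(- delta^2 4^k / 2); exp(-y) <=
   1 / y at y = delta^2 2^k / 2 gives order 2^-k. *)
pose K1 := expR (delta * x) * (2 / delta ^+ 2).
(* Large jumps: 16^k = (2^k)^4 steps meet the factor exp(- 2^k eta), and a fifth power leaves one
   2^-k to spare. The moment at theta + 2^k stays below exp((theta + 1) / 2). *)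
pose K2 := expR (theta * x + (theta + 1) / 2) * ((5`!)%:R / eta ^+ 5).
exists (K1 + K2) => k.
pose M : R := 2 ^+ k.
have M1 : 1 <= M by rewrite exprn_ege1// ler1n.
have M0 : 0 < M by rewrite (lt_le_trans _ M1).
have M4 : 4 ^+ k = M ^+ 2 by rewrite -exprM mulnC exprM; congr (_ ^+ _); ring.
have M16 : (16 ^ k)%:R = M ^+ 4 :> R.
  by rewrite natrX -exprM mulnC exprM; congr (_ ^+ _); ring.
have dt : delta <= theta by rewrite /theta mulr_natl mulr2n lerDl ltW.
have := crossing_lower (mstep k) (@drawdown_step_indep k)
  (fun i a _ => drawdown_step_mgf k i a) theta0 (mgf_theta k) x0 (16 ^ k)
  (ltW eta0) (ltW M0) (ltW delta0) dt.
move=> /le_trans; apply; rewrite leeD2l// lee_fin -/M [leRHS]mulrDl lerD//.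
- rewrite /K1 -mulrA (_ : theta - delta = delta); last by rewrite /theta; ring.
  rewrite ler_wpM2l ?expR_ge0// /drawdown_mgf -expRM_natl M16 M4.
  rewrite [X in expR X](_ : _ = - (delta ^+ 2 / 2 * M ^+ 2)); last first.
    by field; rewrite gt_eqF.
  have y0 : 0 < delta ^+ 2 / 2 * M by rewrite mulr_gt0// divr_gt0// exprn_gt0.
  apply: (@le_trans _ _ (expR (- (delta ^+ 2 / 2 * M)))).
    rewrite ler_expR lerN2 ler_wpM2l//; last by rewrite expr2 ler_peMl// ltW.
    by rewrite divr_ge0// sqr_ge0.
  apply: (le_trans (expRN_le 0 y0)); rewrite factS fact0 muln1 expr1 le_eqVlt.
  by apply/orP; left; apply/eqP; field; rewrite !gt_eqF.
- rewrite M16 /K2 /drawdown_mgf -!expRD M4.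
  have y0 : 0 < M * eta by rewrite mulr_gt0.
  have := expRN_le 4 y0; set F := (5`!)%:R => expM.
  rewrite -[leRHS]mulrA.
  rewrite (_ : F / eta ^+ 5 / M = M ^+ 4 * (F / (M * eta) ^+ 5)); last first.
    by field; rewrite !gt_eqF.
  rewrite mulrCA ler_wpM2l //; first by rewrite exprn_ge0// ltW.
  apply: (@le_trans _ _
    (expR (theta * x + (theta + 1) / 2) * expR (- (M * eta)))); last first.
    by rewrite ler_wpM2l// expR_ge0.
  rewrite -expRD ler_expR [leLHS]addrAC lerD2r lerD2l.
  rewrite [leLHS](_ : _ = (theta / M + 1) / 2); last first.
    by rewrite /theta; field; rewrite gt_eqF.
  by rewrite ler_pM2r ?invr_gt0// lerD2r ler_pdivrMr// ler_peMr.
Qed.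

(** The upper bound passes to the increasing union. For the lower one, [k] grows with [eta] fixed,
    and only then does [eta] tend to 0. *)
Lemma bigcup_grid_crossing_prob x : 0 <= x ->
  P (\bigcup_k grid_crossing x k) = (expR (- (theta * x)))%:E.
Proof.
move=> x0.
have mU : measurable (\bigcup_k grid_crossing x k).
  by apply: bigcupT_measurable => k; exact: measurable_grid_crossing.
apply/eqP; rewrite eq_le; apply/andP; split.
  have := nondecreasing_cvg_mu (measurable_grid_crossing x) mU
    (@grid_crossing_nondecreasing x) (mu := P).
  move=> /cvg_lim <- //; apply: lime_le.
    apply: ereal_nondecreasing_is_cvgn => m n mn; apply: le_measure.
    - by rewrite inE; exact: measurable_grid_crossing.
    - by rewrite inE; exact: measurable_grid_crossing.
    - exact/subsetPset/grid_crossing_nondecreasing.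
  by apply: nearW => k; exact: grid_crossing_upper.
set p := P _.
have pE : p = (fine p)%:E by rewrite fineK// fin_num_measure.
rewrite pE lee_fin expRN -(@ler_pM2l _ (expR (theta * x))) ?expR_gt0//.
rewrite divff ?gt_eqF ?expR_gt0//.
have p0 : 0 <= fine p by rewrite fine_ge0// measure_ge0.
have le_eta eta : 0 < eta -> 1 <= expR (theta * (x + eta)) * fine p.
  move=> eta0; have [K HK] := grid_crossing_lower x0 eta0.
  apply/ler_addgt0Pr => e e0.
  pose k := Num.bound (`|K| / e).
  have Kk : K / 2 ^+ k <= e.
    rewrite ler_pdivrMr ?exprn_gt0// (le_trans (ler_norm K))//.
    rewrite mulrC -ler_pdivrMr// (le_trans (ltW (archi_boundP _)))//.
      by rewrite divr_ge0// ltW.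
    by rewrite -natrX ler_nat ltnW// ltn_expl.
  rewrite (le_trans _ (lerD (lexx _) Kk))// -lee_fin (le_trans (HK k))//.
  rewrite EFinD [(_ * fine p)%:E]EFinM -pE leeD2r// lee_pmul2l// ?lte_fin ?expR_gt0//.
  apply: le_measure; rewrite ?inE//; first exact: measurable_grid_crossing.
  exact: bigcup_sup.
apply/ler_addgt0Pr => e e0.
have theta_gt0 : 0 < theta by rewrite mulr_gt0.
(* With [eta = e / theta] the overshoot costs the factor exp(e), and exp(-e) >= 1 - e. *)
have := le_eta _ (divr_gt0 e0 theta_gt0).
rewrite mulrDr expRD mulrAC mulrCA divff ?gt_eqF// mulr1.
rewrite -ler_pdivrMr ?expR_gt0// div1r -expRN => q_ge.
have := le_trans (expR_ge1Dx (- e)) q_ge.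
by rewrite lerBlDr.
Qed.

End brownian_drawdown.

(** * Clocks *)

Section stable_subordinator_strict.
Context (R : realType) (d : measure_display) (T : measurableType d).
Variables (P : probability T R) (alpha : R) (L : R -> {RV P >-> R}).
Hypothesis alpha0 : 0 < alpha.
Hypothesis subL : stable_subordinator alpha L.

Lemma measurable_level (U : T -> R) (c : R) :
  measurable_fun setT U -> measurable (U @^-1` [set c]).
Proof. by move=> mU; rewrite -[X in measurable X]setTI; exact: mU. Qed.

(** The indicator of L_t = 0 is below exp(- s L_t), whose mean exp(- t s^alpha) tends to 0 as [s]
    grows. *)
Lemma stable_subordinator_neq0 t : 0 < t -> P (L t @^-1` [set 0]) = 0%E.
Proof.
case: subL => _ _ laplace t0.
have m0 : measurable (L t @^-1` [set 0]) by exact: measurable_level.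
set p := P _; have p_ge0 : 0 <= fine p by rewrite fine_ge0// measure_ge0.
have pE : p = (fine p)%:E by rewrite fineK// fin_num_measure.
have le_exp y : 0 < y -> fine p <= expR (- y).
  (* The solution of t s^alpha = y. *)
  move=> y0; pose s := (y / t) `^ alpha^-1.
  have s0 : 0 <= s by exact: powR_ge0.
  have yt0 : 0 <= y / t by rewrite divr_ge0// ltW.
  have sa : t * s `^ alpha = y.
    by rewrite /s -powRrM mulVf ?gt_eqF// powRr1// mulrCA divff ?gt_eqF// mulr1.
  have := laplace s t s0 (ltW t0); rewrite sa => E.
  rewrite -lee_fin -E -pE /p -(expectation_indic P m0).
  apply: expectation_le => //.
  - by apply: measurableT_comp => //; apply: measurableT_comp => //; exact: measurable_funM.
  apply: aeW => w; rewrite indicE; case: (boolP (w \in _)) => [|_].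
    by rewrite inE /= => ->; rewrite mulr0 oppr0 expR0.
  exact: expR_ge0.
rewrite pE; congr EFin; apply/eqP; rewrite eq_le p_ge0 andbT.
apply/ler_addgt0Pr => e e0; rewrite add0r.
rewrite (le_trans (le_exp e^-1 _)) ?invr_gt0//.
by rewrite (le_trans (expRN_le 0 _)) ?invr_gt0// factS fact0 muln1 expr1 invrK mul1r.
Qed.

Lemma stable_subordinator_increments s t : 0 <= s -> s < t ->
  P ((L t \- L s) @^-1` [set 0]) = 0%E.
Proof.
case: subL => -[L0 _ stat _] _ _ s0 st.
have ts0 : 0 < t - s by rewrite subr_gt0.
have := stat s (t - s) s0 (ltW ts0) [set 0] (measurable_set1 _).
rewrite (_ : s + (t - s) = t); last by rewrite addrC subrK.
rewrite /pushforward => ->.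
have mD : measurable ((L (t - s) \- L 0) @^-1` [set 0]).
  by apply: measurable_level; exact: measurable_funB.
apply/negligibleP => //.
have N0 : P.-negligible (L (t - s) @^-1` [set 0]).
  apply/negligibleP; first exact: measurable_level.
  exact: stable_subordinator_neq0.
apply: negligibleS (negligibleU N0 L0) => w /= Lw.
have [L0w|L0w] := eqVneq (L 0 w) 0; last by right=> /= /eqP; apply/negP.
by left; rewrite -Lw /= L0w subr0.
Qed.

(** Uncountably many pairs s < t reduce to countably many dyadic cells: each [s, t] contains a cell
    with nonzero increment, and monotonicity of the path does the rest. *)
Lemma stable_subordinator_increasing :
  {ae P, forall w, forall s t : R, 0 <= s -> s < t -> L s w < L t w}.
Proof.
have [_ mono _] := subL.
have strict : {ae P, forall w, forall k i,
    (L (dyadic k i.+1) \- L (dyadic k i)) w != 0}.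
  apply: ae_foralln => k; apply: ae_foralln => i.
  have lt : dyadic k i < dyadic k i.+1 :> R.
    by rewrite dyadicS ltrDl invr_gt0 exprn_gt0.
  exists ((L (dyadic k i.+1) \- L (dyadic k i)) @^-1` [set 0]); split.
  - by apply: measurable_level; exact: measurable_funB.
  - by apply: stable_subordinator_increments => //; exact: dyadic_ge0.
  - by move=> w /= /negP; rewrite negbK => /eqP.
move: mono strict; apply: filterS2 => w mono strict s t s0 st.
have [k [i [si it]]] := dyadic_between s0 st.
have lt : dyadic k i < dyadic k i.+1 :> R.
  by rewrite dyadicS ltrDl invr_gt0 exprn_gt0.
have nneg (x : R) : 0 <= x -> x \in `[0, +oo[ by move=> x0; rewrite in_itv/= x0.
have Lsi : L s w <= L (dyadic k i) w.
  by apply: mono => //; apply: nneg => //; exact: dyadic_ge0.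
have Lit : L (dyadic k i.+1) w <= L t w.
  by apply: mono => //; apply: nneg => //; rewrite ?dyadic_ge0 ?(le_trans s0 (ltW st)).
rewrite (le_lt_trans Lsi)// (lt_le_trans _ Lit)// lt_neqAle.
apply/andP; split; last by apply: mono => //; [exact: nneg (dyadic_ge0 _ _)..|exact: ltW].
by have := strict k i; rewrite subr_eq0 eq_sym.
Qed.

Lemma inverse_subordinator_onto (Y : R -> {RV P >-> R}) :
  {ae P, forall w, forall t : R, 0 <= t ->
      Y t w = inf [set v : R | 0 <= v /\ t < L v w]} ->
  {ae P, forall w, [set Y t w | t in `[0, +oo[] = `[0, +oo[%classic}.
Proof.
have [[L0 _ _ _] _ _] := subL.
move: L0 stable_subordinator_increasing; apply: filterS3 => w L0 incL YE.
apply/seteqP; split => [_ [t /= + <-]|v /=].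
  rewrite !in_itv/= !andbT => t0; rewrite YE//.
  (* If the path never exceeds [t], the default [inf set0 = 0] is still a nonnegative value. *)
  have [->|/set0P ne] := eqVneq [set v : R | 0 <= v /\ t < L v w] set0.
    by rewrite inf0.
  by apply: lb_le_inf => // v [].
rewrite in_itv/= andbT => v0.
have Lv0 : 0 <= L v w.
  move: v0; rewrite le_eqVlt => /predU1P[<-|v0]; first by rewrite L0.
  by rewrite -L0 ltW// incL.
exists (L v w); first by rewrite /= in_itv/= Lv0.
rewrite YE// (_ : [set _ | _] = `]v, +oo[%classic) ?inf_itv//.
apply/seteqP; split => u /=; rewrite in_itv/= andbT.
  move=> [u0 Lvu]; rewrite ltNge; apply/negP.
  by rewrite le_eqVlt => /predU1P[uv|/(incL _ _ u0)/(lt_trans Lvu)]; rewrite ?uv ltxx in Lvu *.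
by move=> vu; split; [rewrite (le_trans v0 (ltW vu))|exact: incL].
Qed.

End stable_subordinator_strict.

(** * Range of the cumulative intensity *)

Section cumulative_intensity_onto.
Context (R : realType) (lambda : R -> R).
Hypothesis lambda0 : forall s, 0 <= s -> 0 <= lambda s.
Hypothesis loc : locally_integrable [set: R] (lambda \_ `[0, +oo[).
Hypothesis unb :
  ~ has_ubound [set cumulative_intensity lambda t | t in `[0, +oo[].

Let mu : {measure set (measurableTypeR R) -> \bar R} := lebesgue_measure.

Lemma integrable_intensity b : mu.-integrable `[0, b] (EFin \o lambda).
Proof.
have [mlam _ lam_lty] := loc.
have sub : `[0, b] `<=` `[0, +oo[%classic by exact: subset_itvl.
have eqr : {in `[0, b]%classic, lambda \_ `[0, +oo[ =1 lambda}.
  by move=> x /[!inE] xb; rewrite patchE mem_set//; exact: sub.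
have intb := lam_lty `[0, b]%classic (@subsetT _ _) (@segment_compact _ _ _).
apply/integrableP; split.
  apply/measurable_EFinP; apply: (eq_measurable_fun _ eqr).
  exact: measurable_funS mlam.
move: intb; congr (_ < _)%E; apply: eq_integral => x xb.
by rewrite /= eqr.
Qed.

Lemma cumulative_intensity_ge0 t : 0 <= cumulative_intensity lambda t.
Proof.
apply: Rintegral_ge0 => s /=; rewrite in_itv/= => /andP[s0 _].
exact: lambda0.
Qed.

Lemma cumulative_intensity_onto :
  [set cumulative_intensity lambda t | t in `[0, +oo[] = `[0, +oo[%classic.
Proof.
apply/seteqP; split => [_ [t _ <-]|y /=].
  by rewrite /= in_itv/= cumulative_intensity_ge0.
rewrite in_itv/= andbT => y0.
have [t t0 yt] : exists2 t, 0 <= t & y < cumulative_intensity lambda t.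
  apply: contrapT => h; apply: unb; exists y => _ [t /= + <-].
  rewrite in_itv/= andbT => t0; rewrite leNgt; apply/negP => yt.
  by apply: h; exists t.
have cont := parameterized_integral_continuous t0 (integrable_intensity t).
have L0 : cumulative_intensity lambda 0 = 0.
  by rewrite /cumulative_intensity set_itv1 Rintegral_set1.
have Lt0 := cumulative_intensity_ge0 t.
have [|c ct cy] := IVT (v := y) t0 cont.
  rewrite /parameterized_integral -!/(cumulative_intensity lambda _).
  by rewrite L0 min_l// max_r// y0 ltW.
exists c => //; move: ct; rewrite /= !in_itv/= => /andP[-> _] //.
Qed.

End cumulative_intensity_onto.

(* A path property that holds almost surely need not define a measurable set, so
   the integrands of [cond_expectation] are only almost everywhere equal to
   measurable functions. *)
Section nonmeasurable_integrands.
Import HBNNSimple.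

Lemma ge0_ae_le_integral_nonmeasurable (R : realType) (d : measure_display)
    (T : measurableType d) (mu : {measure set T -> \bar R}) (f g : T -> \bar R) :
  (forall w, 0 <= f w)%E -> (forall w, 0 <= g w)%E ->
  {ae mu, forall w, (f w <= g w)%E} ->
  (\int[mu]_w f w <= \int[mu]_w g w)%E.
Proof.
move=> f0 g0 [N [mN N0 fgN]].
rewrite (ge0_integralTE mu f0) (ge0_integralTE mu g0).
apply: ge_ereal_sup => _ [h /= hf <-].
have mI : measurable_fun setT (\1_(~` N) : T -> R).
  by apply: measurable_indic; exact: measurableC.
(* The integral is a supremum over simple functions below the integrand, measurable or not.
   Annihilating [h] on the null set [N] puts it below [g] everywhere and keeps its integral. *)
pose h' : {nnsfun T >-> R} := proj_nnsfun h (measurableC mN).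
apply: (@le_trans _ _ (sintegral mu h')); last first.
  apply: ereal_sup_ubound; exists h' => //= w.
  rewrite /h' /= mindicE; case: (boolP (w \in ~` N)) => [|_].
    rewrite inE /= => Nw; rewrite mulr1 (le_trans (hf w))//.
    by apply: contrapT => /fgN.
  by rewrite mulr0.
rewrite -!integralT_nnsfun le_eqVlt; apply/orP; left; apply/eqP.
apply: ae_eq_integral => //; try exact/measurable_EFinP.
exists N; split => // w /= hw; apply: contrapT => Nw; apply: hw => _.
by rewrite /= mindicE mem_set// mulr1.
Qed.

Lemma ge0_ae_eq_integral_nonmeasurable (R : realType) (d : measure_display)
    (T : measurableType d) (mu : {measure set T -> \bar R}) (f g : T -> \bar R) :
  (forall w, 0 <= f w)%E -> (forall w, 0 <= g w)%E ->
  {ae mu, forall w, f w = g w} ->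
  (\int[mu]_w f w = \int[mu]_w g w)%E.
Proof.
move=> f0 g0 fg; apply/eqP; rewrite eq_le.
by apply/andP; split; apply: ge0_ae_le_integral_nonmeasurable => //;
  apply: filterS fg => w ->.
Qed.

End nonmeasurable_integrands.

(** * Continuous paths on the grid, and the exponential tail *)

Lemma dyadic_exceed (R : realType) (f : R -> R) (c t : R) :
  {within `[0, +oo[, continuous f} -> 0 <= t -> c < f t ->
  exists k i, c < f (dyadic k i).
Proof.
move=> /continuous_within_itvcyP[cf cf0] t0 cft.
have ft : f x @[x --> t^'+] --> f t.
  move: t0; rewrite le_eqVlt => /predU1P[<-//|t0].
  by apply: cvg_at_right_filter; apply: cf; rewrite in_itv/= t0.
have : \forall x \near t^'+, c < f x by exact: (cvgr_gt _ ft).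
rewrite near_withinE => -[e /= e0 He].
(* A dyadic time is sought strictly to the right of [t], which treats t = 0 like the other times. *)
have te : t + e / 3 < t + e * 2 / 3 by rewrite ltrD2l; lra.
have [|k [i [lo up]]] := dyadic_between _ te; first by rewrite addr_ge0// divr_ge0// ltW.
exists k, i; apply: He; last by rewrite (lt_le_trans _ lo)// ltrDl divr_gt0.
have lt : dyadic k i < t + e.
  rewrite (lt_trans (y := dyadic k i.+1))//.
    by rewrite dyadicS ltrDl invr_gt0 exprn_gt0.
  by rewrite (le_lt_trans up)// ltrD2l; lra.
have gt : t < dyadic k i by rewrite (lt_le_trans _ lo)// ltrDl divr_gt0.
by rewrite /= distrC gtr0_norm ?subr_gt0// ltrBlDl.
Qed.

Lemma integral_exponential_tail (R : realType) (theta c : R) : 0 < theta ->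
  (\int[lebesgue_measure]_(r in `[0%R, +oo[) (expR (- (theta * (c + r))))%:E =
   (expR (- (theta * c)) / theta)%:E)%E.
Proof.
move=> theta0.
have mE : measurable_fun setT (fun r : R => (theta * expR (- theta * r))%:E).
  apply/measurable_EFinP; apply: measurable_funM => //.
  by apply: measurableT_comp => //; exact: mulrl_measurable.
have mass : (\int[lebesgue_measure]_(r in `[0%R, +oo[)
    (theta * expR (- theta * r))%:E = 1)%E.
  rewrite -(integral_exponential_pdf theta0) [LHS]integral_mkcond.
  by apply: eq_integral => r _; rewrite /exponential_pdf !patchE; case: ifP.
transitivity (\int[lebesgue_measure]_(r in `[0%R, +oo[)
    ((expR (- (theta * c)) / theta)%:E * (theta * expR (- theta * r))%:E))%E.
  apply: eq_integral => r _; rewrite -EFinM; congr EFin.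
  rewrite mulrA divfK ?gt_eqF// -expRD; congr expR; ring.
rewrite ge0_integralZl ?mass ?mule1//.
- exact: measurable_funS mE.
- by move=> r _; rewrite lee_fin mulr_ge0 ?expR_ge0// ltW.
- by rewrite lee_fin divr_ge0 ?expR_ge0// ltW.
Qed.

(** * The supremum of the drifted Brownian motion *)

Section max_drawdown.
Context (R : realType) (d : measure_display) (T : measurableType d).
Variables (P : probability T R) (W : R -> {RV P >-> R}) (delta : R).
Hypothesis bmW : brownian_motion W.
Hypothesis delta0 : 0 < delta.

Let theta := 2 * delta.
Let theta0 : 0 < theta. Proof. by rewrite mulr_gt0. Qed.

(** All pairs (k, i) in one sequence; an [n] that codes no pair is sent to time 0, itself a grid
    time. *)
Let grid_value n w : \bar R :=
  let ki := odflt (0, 0)%N (unpickle n) in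
  (drawdown W delta (dyadic ki.1 ki.2) w)%:E.

(** A countable supremum, hence measurable for every path; on continuous paths it is the supremum
    over all times. *)
Definition max_drawdown w : \bar R := esups (grid_value ^~ w) 0.

Lemma measurable_max_drawdown : measurable_fun setT max_drawdown.
Proof.
apply: measurable_fun_esups => n; apply/measurable_EFinP.
exact: measurable_drawdown.
Qed.

Lemma drawdown_le_max k i w :
  ((drawdown W delta (dyadic k i) w)%:E <= max_drawdown w)%E.
Proof.
apply: ereal_sup_ubound; exists (pickle (k, i)) => //.
by rewrite /grid_value pickleK.
Qed.

Lemma lt_max_drawdown x w : (x%:E < max_drawdown w)%E <->
  exists k i, x < drawdown W delta (dyadic k i) w.
Proof.
split=> [/ereal_sup_gt[_ [n _ <-]]|[k [i xi]]].
  by rewrite lte_fin => xn; do 2 eexists; exact: xn.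
by rewrite (lt_le_trans _ (drawdown_le_max k i w)).
Qed.

Lemma lt_max_drawdownE x :
  [set w | (x%:E < max_drawdown w)%E] = \bigcup_k grid_crossing W delta x k.
Proof.
apply/seteqP; split => w /=.
  move=> /lt_max_drawdown[k [i xi]].
  have refine n : dyadic (n + k) (4 ^ n * i) = dyadic k i :> R.
    elim: n => [|n IH]; first by rewrite expn0 mul1n.
    by rewrite addSn expnS -mulnA dyadic_refine.
  (* Refining [i] times brings the time within the horizon, since i <= 4^i. *)
  exists (i + k)%N => //; apply/grid_crossingP; exists (4 ^ i * i)%N.
    rewrite (_ : 16 = 4 * 4)%N// expnMn leq_mul//.
      by rewrite leq_exp2l// leq_addr.
    by rewrite (leq_trans (ltnW (ltn_expl i (isT : 1 < 4)%N)))// leq_exp2l// leq_addr.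
  by rewrite refine.
move=> [k _ /grid_crossingP[i _ xi]]; apply/lt_max_drawdown.
by exists k, i.
Qed.

Lemma measurable_lt_max_drawdown x :
  measurable [set w | (x%:E < max_drawdown w)%E].
Proof.
rewrite lt_max_drawdownE; apply: bigcupT_measurable => k.
exact: measurable_grid_crossing.
Qed.

Lemma max_drawdown_gt_prob x : 0 <= x ->
  P [set w | (x%:E < max_drawdown w)%E] = (expR (- (theta * x)))%:E.
Proof. by move=> x0; rewrite lt_max_drawdownE bigcup_grid_crossing_prob. Qed.

Lemma measurable_ge_max_drawdown x :
  measurable [set w | (x%:E <= max_drawdown w)%E].
Proof.
have := emeasurable_fun_c_infty measurableT measurable_max_drawdown x%:E.
by rewrite setTI.
Qed.

(** There is no atom at [x]: the event lies in M > x - e for small e, and the exponential tail is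
    continuous. *)
Lemma max_drawdown_ge_prob x : 0 < x ->
  P [set w | (x%:E <= max_drawdown w)%E] = (expR (- (theta * x)))%:E.
Proof.
move=> x0; have mG := measurable_ge_max_drawdown x.
have mL y := measurable_lt_max_drawdown y.
apply/eqP; rewrite eq_le; apply/andP; split; last first.
  rewrite -(max_drawdown_gt_prob (ltW x0)); apply: le_measure; rewrite ?inE//.
  by move=> w /=; exact: ltW.
set p := P _; have pE : p = (fine p)%:E by rewrite fineK// fin_num_measure.
have le_eps e : 0 < e -> e <= x -> fine p <= expR (- (theta * (x - e))).
  move=> e0 ex; rewrite -lee_fin -pE -max_drawdown_gt_prob ?subr_ge0//.
  apply: le_measure; rewrite ?inE// => w /=; apply: lt_le_trans.
  by rewrite lte_fin ltrBlDr ltrDl.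
have p0 : 0 <= fine p by rewrite fine_ge0// measure_ge0.
have p1 : fine p <= 1 by rewrite -lee_fin -pE probability_le1.
rewrite pE lee_fin; apply/ler_addgt0Pr => e e0.
(* Capped by [x], since the tail formula holds at nonnegative levels only. *)
pose h := Num.min x (e / theta).
have h0 : 0 < h by rewrite lt_min x0 divr_gt0.
have hx : h <= x by rewrite ge_min lexx.
have he : theta * h <= e by rewrite mulrC -ler_pdivlMr// ge_min lexx orbT.
have := le_eps h h0 hx; rewrite mulrBr opprB expRD mulrC.
rewrite -ler_pdivrMr ?expR_gt0// -expRN => /(le_trans _); rewrite -lerBlDr; apply.
apply: (@le_trans _ _ (fine p * (1 - theta * h))).
  by rewrite mulrBr mulr1 lerD2l lerN2 (le_trans _ he)// ler_piMl// mulr_ge0// ltW.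
by rewrite ler_wpM2l// expR_ge1Dx.
Qed.

Lemma measurable_max_drawdown_infty :
  measurable [set w | max_drawdown w = +oo%E].
Proof.
have := measurable_max_drawdown measurableT (emeasurable_set1 +oo%E).
by rewrite setTI.
Qed.

Lemma max_drawdown_infty_prob : P [set w | max_drawdown w = +oo%E] = 0%E.
Proof.
have mI := measurable_max_drawdown_infty.
set p := P _; have pE : p = (fine p)%:E by rewrite fineK// fin_num_measure.
have p0 : 0 <= fine p by rewrite fine_ge0// measure_ge0.
have le_exp y : 0 < y -> fine p <= expR (- (theta * y)).
  move=> y0; rewrite -lee_fin -pE -(max_drawdown_gt_prob (ltW y0)).
  apply: le_measure; rewrite ?inE//; first exact: measurable_lt_max_drawdown.
  by move=> w /= ->; rewrite ltry.
rewrite pE; congr EFin; apply/eqP; rewrite eq_le p0 andbT.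
apply/ler_addgt0Pr => e e0; rewrite add0r.
rewrite (le_trans (le_exp (e * theta)^-1 _)) ?invr_gt0 ?mulr_gt0//.
rewrite invfM mulrCA divff ?gt_eqF// mulr1.
by rewrite (le_trans (expRN_le 0 _)) ?invr_gt0// factS fact0 muln1 expr1 invrK mul1r.
Qed.

(** The mean of a nonnegative variable is the integral of its tail. That formula is for real
    variables, so [fine] is taken, which alters the excess only on the null event M = +oo. *)
Lemma max_drawdown_excess c : 0 <= c ->
  (\int[P]_w maxe (max_drawdown w - c%:E) 0 =
   (expR (- (theta * c)) / theta)%:E)%E.
Proof.
move=> c0.
have mE : measurable_fun setT (fun w => maxe (max_drawdown w - c%:E) 0)%E.
  apply: measurable_maxe => //; apply: emeasurable_funB => //.
  exact: measurable_max_drawdown.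
have mV : measurable_fun setT
    (fun w => fine (maxe (max_drawdown w - c%:E) 0)%E).
  by apply: measurableT_comp mE => //; exact: measurable_fine.
pose V : {RV P >-> R} := mfun_Sub (mem_set mV).
have V0 w : 0 <= V w by rewrite fine_ge0// le_max lexx orbT.
transitivity ('E_P[V])%E.
  rewrite unlock; apply: ae_eq_integral => //; first exact/measurable_EFinP.
  exists [set w | max_drawdown w = +oo%E]; split.
  - exact: measurable_max_drawdown_infty.
  - exact: max_drawdown_infty_prob.
  move=> w /= hw; apply: contrapT => finM; apply: hw => _.
  rewrite /V /= fineK//.
  move/eqP: finM; case: (max_drawdown w) => [r _| |]//.
    by rewrite -EFinB -EFin_max.
  by rewrite addNye max_r// leNye.
rewrite ge0_expectation_ccdf// -(integral_exponential_tail c theta0).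
apply: eq_integral => r; rewrite inE /= in_itv/= andbT => r0.
rewrite -max_drawdown_gt_prob ?addr_ge0//.
have mL : measurable [set w | ((c + r)%:E < max_drawdown w)%E].
  exact: measurable_lt_max_drawdown.
have mI := measurable_max_drawdown_infty.
have mVr : measurable (V @^-1` `]r, +oo[).
  by rewrite -[X in measurable X]setTI; apply: measurable_funPT.
have VE w : max_drawdown w != +oo%E ->
    (r < V w) = ((c + r)%:E < max_drawdown w)%E.
  rewrite /V /=; case: (max_drawdown w) => [m _| |]//.
    by rewrite -EFinB -EFin_max /= lt_max ltrBrDl ltNge r0 orbF lte_fin.
  by rewrite addNye max_r ?leNye//= ltNge r0.
apply/eqP; rewrite /ccdf /distribution /pushforward eq_le; apply/andP; split.
  apply: le_measure; rewrite ?inE// => w /=; rewrite in_itv/= andbT => rV.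
  have [->|Mw] := eqVneq (max_drawdown w) +oo%E; first exact: ltry.
  by rewrite -VE.
rewrite -[leRHS]adde0 -max_drawdown_infty_prob.
have := measureU2 P mVr mI; apply: le_trans.
apply: le_measure; rewrite ?inE//; first exact: measurableU.
move=> w /= Mw; have [Mw'|Mw'] := eqVneq (max_drawdown w) +oo%E; first by right.
by left; rewrite in_itv/= andbT VE.
Qed.

End max_drawdown.

(** * The risk process *)

Lemma risk_infimumE (R : realType) (d : measure_display)
    (T : measurableType d) (P : probability T R) (W : R -> {RV P >-> R})
    (clock : R -> T -> R) (u0 delta : R) (w : T) :
  W 0 w = 0 -> {within `[0, +oo[, continuous (fun t => W t w)} ->
  [set clock t w | t in `[0, +oo[] = `[0, +oo[%classic ->
  risk_infimum W clock u0 delta w = (u0%:E - max_drawdown W delta w)%E.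
Proof.
move=> W0 contW onto.
have dE t : u0 + W t w + delta * t = u0 - drawdown W delta t w.
  by rewrite /drawdown W0; ring.
have cont : {within `[0, +oo[, continuous (fun t => drawdown W delta t w)}.
  move=> x; apply: cvgB.
    by apply: cvgN; apply: cvgB; [exact: contW|exact: cvg_cst].
  apply: cvgM; first exact: cvg_cst.
  have cid : {within `[0, +oo[, continuous (@id R)}.
    by apply: continuous_subspaceT => y; exact: cvg_id.
  exact: cid.
apply/eqP; rewrite eq_le; apply/andP; split.
- rewrite -leeBlDl// leeNr.
  (* Each grid time is a value of the clock, as the clock is onto. *)
  apply: ge_ereal_sup => _ [n _ <-]; set ki := odflt _ _.
  rewrite leeNr leeBlDl// -EFinB -dE.
  apply: ereal_inf_lbound.
  have : [set clock t w | t in `[0, +oo[] (dyadic ki.1 ki.2).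
    by rewrite onto /= in_itv/= dyadic_ge0.
  by move=> [t t0 tE]; exists t => //; rewrite tE.
- apply/ereal_infP => _ [t t0 <-]; rewrite dE EFinB leeB//.
  have ct0 : 0 <= clock t w.
    suff : `[0, +oo[%classic (clock t w) by rewrite /= in_itv/= andbT.
    by rewrite -onto; exists t.
  (* If the drawdown at a clock value exceeded the grid supremum, continuity would give a grid time
     at which it does so too. *)
  rewrite leNgt; apply/negP.
  have := fun k i => drawdown_le_max W delta k i w.
  case: (max_drawdown W delta w) => [m|//|] le_m.
    rewrite lte_fin => /(dyadic_exceed cont ct0)[k [i]].
    by rewrite ltNge -lee_fin le_m.
  by have := le_m 0%N 0%N; rewrite leeNy_eq.
Qed.

(** Lack of memory: the mean excess over [u0] and the ruin probability share the factor exp(- theta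
    u0), so the initial capital cancels. *)
Lemma neg_mean_risk_infimum (R : realType) (d : measure_display)
    (T : measurableType d) (P : probability T R) (W : R -> {RV P >-> R})
    (clock : R -> T -> R) (u0 delta : R) :
  brownian_motion W -> 0 < delta -> 0 < u0 ->
  {ae P, forall w, [set clock t w | t in `[0, +oo[] = `[0, +oo[%classic} ->
  let Rinf := risk_infimum W clock u0 delta in
  (- cond_expectation P Rinf [set w | (Rinf w <= 0)%E])%E =
  ((2 * delta)^-1)%:E.
Proof.
move=> bmW delta0 u00 onto Rinf.
have [W0 _ _ contW] := bmW.
have RE : {ae P, forall w, Rinf w = (u0%:E - max_drawdown W delta w)%E}.
  by move: W0 contW onto; apply: filterS3 => w; exact: risk_infimumE.
pose theta := 2 * delta.
have theta0 : 0 < theta by rewrite mulr_gt0.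
set A := [set w | _].
pose B := [set w | (u0%:E <= max_drawdown W delta w)%E].
have mB : measurable B by exact: measurable_ge_max_drawdown.
have PA : 'E_P[\1_A]%E = (expR (- (theta * u0)))%:E.
  rewrite -(max_drawdown_ge_prob bmW delta0 u00) -/B -(expectation_indic P mB).
  rewrite unlock; apply: ge0_ae_eq_integral_nonmeasurable.
  - by move=> w; rewrite lee_fin.
  - by move=> w; rewrite lee_fin.
  apply: filterS RE => w RwE; congr (_%:E); rewrite !indicE; congr (_%:R).
  by congr (nat_of_bool _); apply/idP/idP; rewrite !inE /A /B /= RwE sube_le0.
have intA : (\int[P]_(w in A) Rinf w = - (expR (- (theta * u0)) / theta)%:E)%E.
  rewrite -(max_drawdown_excess bmW delta0 (ltW u00)).
  rewrite integral_mkcond.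
  have neg0 w : (0 <= - (Rinf \_ A) w)%E.
    rewrite patchE; case: ifP => [|_]; last by rewrite oppe0.
    by rewrite inE /A /= oppe_ge0.
  (* The integrand is nonpositive; a sign change brings it under the comparison for nonnegative,
     possibly nonmeasurable functions. *)
  transitivity (\int[P]_w - (- (Rinf \_ A) w))%E.
    by apply: eq_integral => w _; rewrite oppeK.
  rewrite integral_ge0N//; congr (- _)%E.
  apply: ge0_ae_eq_integral_nonmeasurable => //.
    by move=> w; rewrite le_max lexx orbT.
  apply: filterS RE => w RwE; rewrite patchE.
  case: ifPn => [|]; rewrite ?notin_setE ?inE /A /= RwE sube_le0.
    by move=> uM; rewrite EFinN max_l ?sube_ge0// oppeB ?fin_num_adde_defr// addeC.
  by move=> /negP; rewrite -ltNge oppr0 EFinN => Mu; rewrite max_r// sube_le0 ltW.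
rewrite /cond_expectation intA PA mulNe oppeK -EFinM; congr EFin.
by rewrite mulrAC divff ?mul1r// gt_eqF// expR_gt0.
Qed.

(** * Finiteness of the mean claim and the recovery capital *)

(** Since (|X| - 1)^2 >= 0, |X| is below 1 + X^2. This keeps [fine] from turning an infinite mean
    into 0. *)
Lemma expectation_fin_of_second_moment (R : realType) (d : measure_display)
    (T : measurableType d) (P : probability T R) (X : {RV P >-> R}) :
  ('E_P[fun w => (X w ^+ 2)%R] < +oo)%E -> ('E_P[X])%E \is a fin_num.
Proof.
move=> X2.
have mX2 : measurable_fun setT (fun w => X w ^+ 2) by exact: measurable_funX.
have iX2 : P.-integrable setT (fun w => (1 + X w ^+ 2)%:E).
  apply/integrableP; split.
    by apply/measurable_EFinP; exact: measurable_funD.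
  rewrite (eq_integral (fun w => ((cst 1 \+ fun w => X w ^+ 2) w)%:E)); last first.
    by move=> w _; rewrite gee0_abs// lee_fin addr_ge0 ?sqr_ge0.
  suff : ('E_P[cst 1%R \+ fun w => (X w ^+ 2)%R] < +oo)%E by rewrite unlock.
  rewrite ge0_expectationD//; last by move=> w; exact: sqr_ge0.
  by rewrite expectation_cst lte_add_pinfty// ltry.
rewrite unlock; apply: integrable_fin_num => //.
apply: le_integrable iX2 => //; first exact/measurable_EFinP.
move=> w _ /=; rewrite lee_fin [leRHS]ger0_norm ?addr_ge0 ?sqr_ge0//.
rewrite -(real_normK (num_real (X w))).
have := sqr_ge0 (`|X w| - 1); set y := `|X w| => y2.
by have := normr_ge0 (X w); rewrite -/y => y0; nra.
Qed.

Theorem corollary21 (R : realType) (d : measure_display)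
    (Omega : measurableType d) (P : probability Omega R)
    (X : {RV P >-> R}) (rho u alpha : R)
    (W Y : R -> {RV P >-> R}) (lambda : R -> R) (T : R -> Omega -> R) :
  (0 < 'E_P[X])%E ->
  (0 < 'E_P[fun w => (X w ^+ 2)%R])%E ->
  ('E_P[fun w => (X w ^+ 2)%R] < +oo)%E ->
  0 < rho -> 0 < u ->
  brownian_motion W ->
  0 < alpha -> alpha < 1 ->
  inverse_stable_subordinator alpha Y ->
  independent_processes Y W ->
  (forall s, 0 <= s -> 0 <= lambda s) ->
  locally_integrable [set: R] (lambda \_ `[0, +oo[) ->
  ~ has_ubound [set cumulative_intensity lambda t | t in `[0, +oo[] ->
  [\/ T = (fun t _ => t),
      T = (fun t w => Y t w),
      T = (fun t _ => cumulative_intensity lambda t) |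
      T = (fun t w => cumulative_intensity lambda (Y t w))] ->
  let EX := fine ('E_P[X])%E in
  let EX2 := fine ('E_P[fun w => (X w ^+ 2)%R])%E in
  let delta := rho * EX / EX2 in
  let u0 := u / EX2 in
  let Rinf := risk_infimum W T u0 delta in
  let kappa := (- cond_expectation P Rinf [set w | (Rinf w <= 0)%E])%E in
  kappa = (EX2 / (2 * rho * EX))%:E.
Proof.
move=> EX0 EX20 EX2y rho0 u0 bmW alpha0 _ [L [subL YE]] _ lam0 loc unb TE EX EX2
  delta u0' Rinf kappa.
have EXf := expectation_fin_of_second_moment EX2y.
have EXp : 0 < EX by rewrite fine_gt0// EX0 ltey_eq EXf.
have EX2p : 0 < EX2 by rewrite fine_gt0// EX20 EX2y.
have deltap : 0 < delta by rewrite divr_gt0// mulr_gt0.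
have u0p : 0 < u0' by rewrite divr_gt0.
have onto : {ae P, forall w, [set T t w | t in `[0, +oo[] = `[0, +oo[%classic}.
  have ontoY := inverse_subordinator_onto alpha0 subL YE.
  have ontoL := cumulative_intensity_onto lam0 loc unb.
  case: TE => ->.
  - by apply: aeW => w; exact: image_id.
  - exact: ontoY.
  - exact: aeW.
  - apply: filterS ontoY => w Yw.
    by rewrite -[RHS]ontoL -[in RHS]Yw image_comp.
rewrite /kappa (neg_mean_risk_infimum bmW deltap u0p onto); congr EFin.
by rewrite /delta; field; rewrite !gt_eqF.
Qed.
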